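(* Let $S$ be the set of all even positive integers and let $G$ be a connected graph. Then $G$ admits an $S$-Hamiltonian cycle if and only if $G$ is non-bipartite.
   Context: All graphs are finite, simple, undirected, without self-loops, non-empty and connected. A graph is bipartite if its vertex set can be partitioned into two non-empty sets such that every edge joins the two sets. A walk of length $k$ is a sequence of vertices $(u_0,\dots,u_k)$ with consecutive vertices adjacent; vertices may repeat. For $S \subseteq \mathbb{N}^+$, an $S$-Hamiltonian cycle of $G$ is a sequence $(v_1,\dots,v_n)$ listing every vertex of $G$ exactly once such that for each $i<n$, and also for the pair $(v_n,v_1)$, the two vertices are joined by a walk in $G$ whose length lies in $S$.
   Formalization: The graph is assumed to have at least two vertices: the one-vertex graph is connected and non-bipartite (it has no partition into two non-empty sets) but has no walk of positive length, hence no S-Hamiltonian cycle, so the claim fails for it. *)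

(* Defs.v *)
From mathcomp Require Import all_boot.

Set Implicit Arguments.
Unset Strict Implicit.
Unset Printing Implicit Defensive.

(* A simple graph on V is a symmetric irreflexive [e : rel V]. *)

Definition connected_graph (V : finType) (e : rel V) : Prop :=
  0 < #|V| /\ forall x y : V, connect e x y.

Definition bipartite (V : finType) (e : rel V) : Prop :=
  exists A B : {set V},
    [/\ A != set0, B != set0, A :|: B = setT, [disjoint A & B] &
        forall x y : V, e x y ->
          (x \in A) && (y \in B) || (x \in B) && (y \in A)].

(* The walk (x, w_0, ..., w_(k-1)) has length k = size w. *)
Definition joined (V : finType) (S : pred nat) (e : rel V) (x y : V) : Prop :=
  exists w : seq V, [/\ path e x w, last x w = y & size w \in S].

(* The default value x0 is irrelevant: the indices are in range, and s is
   non-empty as soon as V has an element x0. For a one-vertex sequence the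
   closing condition asks for a closed walk of length in S. *)
Definition hamiltonian_cycle (V : finType) (S : pred nat) (e : rel V)
    (s : seq V) : Prop :=
  [/\ uniq s,
      forall x : V, x \in s,
      forall (x0 : V) (i : nat), i.+1 < size s ->
        joined S e (nth x0 s i) (nth x0 s i.+1) &
      forall x0 : V, joined S e (last x0 s) (head x0 s)].

Definition even_positive : pred nat := [pred k | (0 < k) && ~~ odd k].

(* Main.v *)
Require Import Defs.
From mathcomp Require Import all_boot.

(** Call two vertices "two-step adjacent" when they have a common neighbour; an
    even walk is a path for this relation.  Along an even walk the side of a
    bipartition never changes, so a bipartite graph has no cycle as required.
    Conversely let [A] be a two-step component and [B] the set of neighbours of
    [A].  They cover the graph, and if they are disjoint they form a
    bipartition.  If they meet, then [A] is contained in [B], because [B] is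
    also closed under two-step adjacency, and it follows that [A] is
    everything.  Any enumeration of the vertices is then a Hamiltonian cycle. *)

Definition two_step {V : finType} (e : rel V) : rel V :=
  [rel x y | [exists z, e x z && e z y]].

Lemma two_stepI {V : finType} (e : rel V) (x y z : V) :
  e x z -> e z y -> two_step e x y.
Proof. by move=> exz ezy; apply/existsP; exists z; rewrite exz. Qed.

Lemma path_bipartition_parity {V : finType} (e : rel V) (A : {set V}) :
  (forall x y, e x y -> (y \in A) = (x \notin A)) ->
  forall w x, path e x w -> (last x w \in A) = odd (size w) (+) (x \in A).
Proof.
move=> eA; elim=> [|y w IHw] x //= /andP[exy /IHw ->].
by rewrite (eA _ _ exy) addbN addNb.
Qed.

Lemma bipartition_flip {V : finType} (e : rel V) (A B : {set V}) :
  [disjoint A & B] ->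
  (forall x y, e x y -> (x \in A) && (y \in B) || (x \in B) && (y \in A)) ->
  forall x y, e x y -> (y \in A) = (x \notin A).
Proof.
move=> disAB eAB x y /eAB /orP[] /andP[].
  by move=> -> yB; rewrite (disjointFl disAB yB).
by move=> xB ->; rewrite (disjointFl disAB xB).
Qed.

Lemma hamiltonian_even_not_bipartite {V : finType} (e : rel V) (s : seq V) :
  hamiltonian_cycle even_positive e s -> ~ bipartite e.
Proof.
move=> [_ s_all s_step _] [A [B [/set0Pn[a aA] /set0Pn[b bB] _ disAB eAB]]].
have parity := path_bipartition_parity e A (bipartition_flip e A B disAB eAB).
have side i : i < size s -> (nth a s i \in A) = (nth a s 0 \in A).
  elim: i => // i IHi lt_i_s; rewrite -(IHi (ltnW lt_i_s)).
  have [w [ew <- /andP[_ even_w]]] := s_step a i lt_i_s.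
  by rewrite (parity _ _ ew) (negbTE even_w).
(* As [s] lists every vertex, [A] is everything or empty, whereas both sides of a bipartition are
   inhabited. *)
have sideE x : (x \in A) = (nth a s 0 \in A).
  by rewrite -(side (index x s)) ?index_mem // nth_index.
by move: (disjointFl disAB bB); rewrite sideE -(sideE a) aA.
Qed.

(** Each two-step adjacency expands into two edges. The length may be 0, when [x = y], so positivity
    has to be secured separately. *)
Lemma connect_two_step_walk {V : finType} (e : rel V) (x y : V) :
  connect (two_step e) x y ->
  exists w, [/\ path e x w, last x w = y & ~~ odd (size w)].
Proof.
case/connectP=> p + ->; elim: p x => [|u p IHp] x /=; first by exists [::].
case/andP=> /existsP[z /andP[exz ezu]] /IHp[w [ew lw ow]].
by exists [:: z, u & w]; rewrite /= exz ezu negbK.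
Qed.

Lemma connected_has_neighbour {V : finType} (e : rel V) :
  (forall x y, connect e x y) -> 1 < #|V| -> forall x, exists y, e x y.
Proof.
move=> conn V_gt1 x; have /card_gt1P[u [v [_ _ neq_uv]]] := V_gt1.
have [y neq_yx] : exists y, y != x.
  by have [eq_ux|] := eqVneq u x; [exists v; rewrite -eq_ux eq_sym | exists u].
case/connectP: (conn x y) neq_yx => [[|z p]] /= => [_ ->|]; first by rewrite eqxx.
by case/andP=> exz _ _ _; exists z.
Qed.

Lemma connected_closed_pred {V : finType} (e : rel V) (P : pred V) (x : V) :
  P x -> (forall u v, e u v -> P u -> P v) -> forall y, connect e x y -> P y.
Proof.
move=> Px Pe y /connectP[p + ->]; elim: p x Px => //= u p IHp x Px.
by case/andP=> /Pe/(_ Px)/IHp.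
Qed.

Lemma not_bipartite_two_step_connected {V : finType} (e : rel V) :
  symmetric e -> (forall x y, connect e x y) -> 1 < #|V| ->
  ~ bipartite e -> forall x y, connect (two_step e) x y.
Proof.
move=> e_sym conn V_gt1 not_bip x.
pose A := [set y | connect (two_step e) x y].
pose B := [set y | [exists z, (z \in A) && e z y]].
have xA : x \in A by rewrite inE.
have A_closed u v w : u \in A -> e u v -> e v w -> w \in A.
  rewrite !inE => xu euv evw.
  exact: connect_trans xu (connect1 (two_stepI e u w v euv evw)).
have AB u v : u \in A -> e u v -> v \in B.
  by move=> uA euv; rewrite inE; apply/existsP; exists u; rewrite uA.
have BA u v : u \in B -> e u v -> v \in A.
  rewrite [in X in X -> _]inE => /existsP[z /andP[zA ezu]].
  exact: A_closed z u v zA ezu.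
(* By [AB] and [BA] the union of [A] and [B] is closed under adjacency, and it contains [x]. *)
have cover y : (y \in A) || (y \in B).
  apply: (connected_closed_pred e (fun y => (y \in A) || (y \in B)) x) => //.
    by rewrite xA.
  move=> u v euv /orP[uA | uB]; first by rewrite (AB u v) // orbT.
  by rewrite (BA u v).
have [w wA wB] : exists2 w, w \in A & w \in B.
  have [disAB | /pred0Pn[w /andP[wA wB]]] := boolP [disjoint A & B];
    last by exists w.
  case: not_bip; exists A, B; split=> //.
  - by apply/set0Pn; exists x.
  - have [z exz] := connected_has_neighbour e conn V_gt1 x.
    by apply/set0Pn; exists z; exact: AB x z xA exz.
  - by apply/setP=> y; rewrite in_setU cover inE.
  move=> u v euv; case/orP: (cover u) => [uA | uB].
    by rewrite uA (AB u v).
  by rewrite uB (BA u v) ?orbT.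
have B_closed u v : two_step e u v -> u \in B -> v \in B.
  by case/existsP=> z /andP[euz ezv] uB; exact: AB z v (BA u z uB euz) ezv.
have two_step_sym : connect_sym (two_step e).
  apply: sym_connect_sym => u v /=.
  by apply: eq_existsb => z; rewrite andbC e_sym (e_sym u).
(* Any [a] in [A] is linked to [w] through [x] by two-step adjacency, so membership in [B] spreads
   from [w] to [a]. *)
have subAB a : a \in A -> a \in B.
  move: wA; rewrite !(in_set (connect _ _)) => xw xa.
  apply: (connected_closed_pred _ [in B] _ wB B_closed).
  by apply: connect_trans xa; rewrite two_step_sym.
move=> y; suff: y \in A by rewrite inE.
(* A vertex [y] of [B] has a neighbour [a] in [A]; since [a] is also in [B], its neighbour [y] is in
   [A]. *)
case/orP: (cover y) => //; rewrite [in X in X -> _]inE.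
by case/existsP=> a /andP[/subAB aB eay]; exact: BA a y aB eay.
Qed.

(** The bound [V_gt1] excludes the one-vertex graph: it has no bipartition into two non-empty sides,
    but also no closed walk of positive length. *)
Theorem theorem20 (V : finType) (e : rel V)
  (e_sym : symmetric e) (e_irr : irreflexive e)
  (e_conn : connected_graph e) (V_gt1 : 1 < #|V|) :
  (exists s : seq V, hamiltonian_cycle even_positive e s) <-> ~ bipartite e.
Proof.
case: e_conn => _ conn; split=> [[s] | not_bip].
  exact: hamiltonian_even_not_bipartite e s.
have all_joined x y : joined even_positive e x y.
  have [w [ew lw even_w]] := connect_two_step_walk e x y
    (not_bipartite_two_step_connected e e_sym conn V_gt1 not_bip x y).
  (* The detour x, z, x makes the length positive. *)
  have [z exz] := connected_has_neighbour e conn V_gt1 x.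
  exists [:: z, x & w]; split=> //=; first by rewrite exz e_sym exz.
  by rewrite inE /= negbK.
exists (enum V); split=> //; first exact: enum_uniq.
by move=> x; rewrite mem_enum.
Qed.
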